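(* Let $X_0\in\Gamma_1$ and let $(X_n)_{n\ge0}$ be the sequence produced by the iterative proportional fitting procedure started at $X_0$ with target marginals $a,b$. The matrices $\lim_nX_{2n}$ and $\lim_nX_{2n+1}$ have the same support $\Sigma$, and $\Sigma$ is the union of the supports of all matrices in $\Gamma(a',b,X_0)\cup\Gamma(a,b',X_0)$. Moreover, if $X'_0$ denotes the matrix obtained from $X_0$ by setting to $0$ all entries outside $\Sigma$, then the limit points provided by the iterative proportional fitting procedure (with target marginals $a,b$) starting from $X_0$ and from $X'_0$ coincide, i.e. denoting by $(X'_n)_{n\ge0}$ the sequence started from $X'_0$, $\lim_nX'_{2n}=\lim_nX_{2n}$ and $\lim_nX'_{2n+1}=\lim_nX_{2n+1}$.
   Context: Fix integers $p,q\ge 2$ and vectors $a=(a_1,\dots,a_p)$, $b=(b_1,\dots,b_q)$ with positive components such that $\sum_i a_i=\sum_j b_j=1$. For a $p\times q$ matrix $X$, set $X(i,+)=\sum_jX(i,j)$, $X(+,j)=\sum_iX(i,j)$, $R_i(X)=X(i,+)/a_i$, $C_j(X)=X(+,j)/b_j$. $\Gamma_0$ is the set of non-negative $p\times q$ matrices all of whose row sums and column sums are positive; $\Gamma_1$ is the set of $X\in\Gamma_0$ whose entries sum to $1$. $\mathrm{Supp}(X)=\{(i,j):X(i,j)>0\}$. For vectors $\alpha,\beta$ with positive components, $\Gamma(\alpha,\beta)$ is the set of $X\in\Gamma_0$ with $X(i,+)=\alpha_i$ for all $i$ and $X(+,j)=\beta_j$ for all $j$, and $\Gamma(\alpha,\beta,X_0)=\{S\in\Gamma(\alpha,\beta):\mathrm{Supp}(S)\subset\mathrm{Supp}(X_0)\}$.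 Iterative proportional fitting procedure (IPFP): for $X\in\Gamma_0$ let $T_R(X)(i,j)=X(i,j)/R_i(X)$ and $T_C(X)(i,j)=X(i,j)/C_j(X)$; started at a matrix $X_0\in\Gamma_0$, it produces $X_{2n+1}=T_R(X_{2n})$ and $X_{2n+2}=T_C(X_{2n+1})$ for all $n\ge0$. The sequences $(X_{2n})_{n\ge0}$, $(X_{2n+1})_{n\ge0}$, $(R_i(X_{2n}))_{n\ge0}$ and $(C_j(X_{2n+1}))_{n\ge0}$ converge, the latter two to positive limits. The vectors $a'=(a'_i)$ and $b'=(b'_j)$ are defined by $a'_i=a_i\lim_nR_i(X_{2n})$ and $b'_j=b_j\lim_nC_j(X_{2n+1})$. *)

(* Defs.v *)
From HB Require Import structures.
From mathcomp Require Import all_boot all_order all_algebra.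
From mathcomp Require Import all_classical all_reals all_analysis.

Set Implicit Arguments.
Unset Strict Implicit.
Unset Printing Implicit Defensive.

Import Order.TTheory GRing.Theory Num.Theory.
Import numFieldNormedType.Exports.

Local Open Scope classical_set_scope.
Local Open Scope ring_scope.

Section IPFP.
Context {R : realType} {p q : nat}.
Implicit Types (a : 'I_p -> R) (b : 'I_q -> R) (X : 'M[R]_(p, q)).

Definition rowsum X (i : 'I_p) : R := \sum_j X i j.

Definition colsum X (j : 'I_q) : R := \sum_i X i j.

Definition rowratio a X (i : 'I_p) : R := rowsum X i / a i.

Definition colratio b X (j : 'I_q) : R := colsum X j / b j.

Definition Gamma0 : set 'M[R]_(p, q) :=
  [set X : 'M[R]_(p, q) | [/\ forall i j, 0 <= X i j,
               forall i, 0 < rowsum X i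
             & forall j, 0 < colsum X j]].

Definition Gamma1 : set 'M[R]_(p, q) :=
  [set X : 'M[R]_(p, q) | Gamma0 X /\ \sum_i \sum_j X i j = 1].

Definition Supp X : set ('I_p * 'I_q) := [set ij | 0 < X ij.1 ij.2].

(* Because of the condition [Gamma0], this is empty unless both [alpha] and
   [beta] have positive components. *)
Definition Gamma (alpha : 'I_p -> R) (beta : 'I_q -> R) : set 'M[R]_(p, q) :=
  [set X : 'M[R]_(p, q) | [/\ Gamma0 X,
               forall i, rowsum X i = alpha i
             & forall j, colsum X j = beta j]].

Definition Gamma_in (alpha : 'I_p -> R) (beta : 'I_q -> R) X0 :
    set 'M[R]_(p, q) :=
  [set S | Gamma alpha beta S /\ Supp S `<=` Supp X0].

(* [T_R] and [T_C] are total, with the convention [x / 0 = 0]; on [Gamma0] no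
   division by zero occurs. *)
Definition T_R a X : 'M[R]_(p, q) := \matrix_(i, j) (X i j / rowratio a X i).

Definition T_C b X : 'M[R]_(p, q) := \matrix_(i, j) (X i j / colratio b X j).

Fixpoint ipfp a b X0 (n : nat) : 'M[R]_(p, q) :=
  if n is m.+1 then
    if odd m then T_C b (ipfp a b X0 m) else T_R a (ipfp a b X0 m)
  else X0.

Definition restrict_mx X (A : set ('I_p * 'I_q)) : 'M[R]_(p, q) :=
  \matrix_(i, j) (if (i, j) \in A then X i j else 0).

End IPFP.

(* Main.v *)
Require Import Defs.
From HB Require Import structures.
From mathcomp Require Import all_boot all_order all_algebra.
From mathcomp Require Import all_classical all_reals all_analysis.
From mathcomp Require Import ring lra.

Set Implicit Arguments.
Unset Strict Implicit.
Unset Printing Implicit Defensive.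

Import Order.TTheory GRing.Theory Num.Theory.
Import numFieldNormedType.Exports.

Local Open Scope classical_set_scope.
Local Open Scope ring_scope.

(** The procedure is an alternating minimisation of relative entropy
    D(P | Q) = sum P ln (P / Q) between the matrices P with row sums [a] and the
    matrices Q with column sums [b]; this is what makes it converge even when no
    matrix supported by [X0] has both marginals.

    Convergence.  Write x_n for the iterates, A_n for D(x_{2n+1} | x_{2n})
    ([row_divergence]) and B_n for D(x_{2n+1} | x_{2n+2}) ([col_divergence]).
    Both depend only on the ratios, and once the column sums of x_0 are [b],
    which costs two steps, Gibbs' inequality gives A_n >= B_n >= A_{n+1}.
    The odd iterates live in a compact set, so they converge to some P along an
    ultrafilter; by monotonicity the value d that P gives to B_n is a lower
    bound of all A_n.
    If S has row sums [a], the column sums of P and a support inside that of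
    [X0], one full cycle of the procedure changes sum S ln x_{2n} by
    A_n - sum_j S(+,j) ln C_j(x_{2n+1}), which is at least
    A_n - d >= 0 by Gibbs again ([cross_entropy_even_le]).  Hence
    sum S ln x_{2n} is nondecreasing.  For S = P this forces D(P | x_{2n+1}) to
    converge, and its limit is 0 because it is 0 along the ultrafilter.
    Relative entropy dominates the squared Hellinger distance, so x_{2n+1}
    converges to P ([ipfp_odd_cvg]) and x_{2n} to Q = T_C P, with P = T_R Q.

    Support.  For a general S as above the monotone quantity is bounded below,
    so x_{2n} cannot tend to 0 at an entry where S is positive: P has the
    largest support in Gamma(a, b', X0).  Let rho_i = R_i(Q) and
    gamma_j = C_j(P).  Then rho_i gamma_j = 1 on the common support of P and Q,
    as Q = T_C (T_R Q), and rho_i gamma_j >= 1 on the support of [X0], as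
    otherwise x_{2n}(i, j) would eventually increase ([limits_ratio_ge1]).
    With this inequality, dividing the rows by rho sends Gamma(a', b, X0) into
    Gamma(a, b', X0) without changing supports ([Gamma_in_rescale]).

    Restriction.  Let P', Q', rho', gamma' come from the start [X0'].  Pairing
    ln rho + ln gamma and ln rho' + ln gamma' with P and P' and using the two
    facts on rho gamma yields
    sum_j b_j (gamma_j - gamma'_j) (ln gamma_j - ln gamma'_j) <= 0,
    so gamma = gamma' ([restrict_colratio]).  Thus P and P' have the same
    marginals, and the same support by maximality.  The pairing of P' - P with
    the logarithm of the iterates never changes along the procedure, whence
    sum (P' - P) (ln P' - ln P) = 0 and P' = P ([restrict_limit_odd]). *)

(** * Logarithm inequalities *)

Section logarithm.
Variable R : realType.
Implicit Types x y : R.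

Lemma ln_le_sub1 x : 0 < x -> ln x <= x - 1.
Proof.
move=> x0; have -> : ln x = ln (1 + (x - 1)) by congr ln; lra.
by apply: le_ln1Dx; lra.
Qed.

(** The form ln t <= t - 1 takes when summed against weights; the hypothesis on
    the sum of [y / x] replaces the equality of total masses, and lets one lemma
    serve for marginals and for whole matrices. *)
Lemma gibbs (I : finType) (w x y : I -> R) :
    (forall i, 0 <= w i) -> (forall i, 0 < x i) -> (forall i, 0 < y i) ->
    \sum_i w i * (y i / x i) <= \sum_i w i ->
  \sum_i w i * ln (y i) <= \sum_i w i * ln (x i).
Proof.
move=> w0 x0 y0 h; rewrite -subr_le0 -sumrB.
rewrite -subr_le0 -sumrB in h; apply: le_trans h; apply: ler_sum => i _.
rewrite -!mulrBr -ln_div ?posrE// -[X in _ <= _ - X]mulr1 -mulrBr.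
by rewrite ler_wpM2l// ln_le_sub1// divr_gt0.
Qed.

Lemma ln_sub_mul_ge0 x y : 0 < x -> 0 < y -> 0 <= (x - y) * (ln x - ln y).
Proof.
move=> x0 y0; case: (lerP x y) => xy.
  by rewrite mulr_le0// subr_le0// ler_ln ?posrE.
by rewrite mulr_ge0// subr_ge0 ?ler_ln ?posrE// ltW.
Qed.

Lemma ln_sub_mul_eq0 x y :
  0 < x -> 0 < y -> (x - y) * (ln x - ln y) = 0 -> x = y.
Proof.
move=> x0 y0 /eqP; rewrite mulf_eq0 !subr_eq0 => /orP[/eqP//|/eqP].
by apply: ln_inj; rewrite posrE.
Qed.

(** Termwise, so that [x - p] cancels in the sum of two distributions.  It comes
    from ln t <= t - 1 at [t = sqrt (x / p)], and lets relative entropy control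
    convergence entry by entry. *)
Lemma hellinger_le_entropy_term (p x : R) :
    0 <= p -> 0 <= x -> (0 < p -> 0 < x) ->
  (Num.sqrt x - Num.sqrt p) ^+ 2 <= p * ln p - p * ln x + (x - p).
Proof.
move=> p0 x0 px; have [->|pn0] := eqVneq p 0.
  by rewrite sqrtr0 subr0 sqr_sqrtr//; lra.
have {pn0} p_gt0 : 0 < p by rewrite lt_neqAle eq_sym pn0.
have {px} x_gt0 := px p_gt0.
rewrite sqrrB !sqr_sqrtr//.
set u := Num.sqrt x; set v := Num.sqrt p.
have u0 : 0 < u by rewrite sqrtr_gt0.
have v0 : 0 < v by rewrite sqrtr_gt0.
have xE : x = u ^+ 2 by rewrite sqr_sqrtr.
have pE : p = v ^+ 2 by rewrite sqr_sqrtr.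
have h : ln x - ln p <= 2 * (u / v - 1).
  rewrite xE pE !lnXn// -mulrnBl -ln_div ?posrE// mulr_natl ler_pMn2r//.
  by rewrite ln_le_sub1// divr_gt0.
have := ler_wpM2l p0 h.
have -> : p * (2 * (u / v - 1)) = 2 * (u * v) - 2 * p.
  by rewrite pE; field; rewrite gt_eqF.
lra.
Qed.

End logarithm.

(** * Scaling steps and entropy *)

Section scaling.
Context {R : realType} {p q : nat}.
Implicit Types (a : 'I_p -> R) (b : 'I_q -> R) (X Y Z : 'M[R]_(p, q)).

Lemma sum_rowsum X (f : 'I_p -> R) :
  \sum_i \sum_j X i j * f i = \sum_i rowsum X i * f i.
Proof. by apply: eq_bigr => i _; rewrite mulr_suml. Qed.

Lemma sum_colsum X (g : 'I_q -> R) :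
  \sum_i \sum_j X i j * g j = \sum_j colsum X j * g j.
Proof. by rewrite exchange_big; apply: eq_bigr => j _; rewrite mulr_suml. Qed.

Lemma total_colsum X : \sum_j colsum X j = \sum_i rowsum X i.
Proof. exact: exchange_big. Qed.

Section positivity.
Variable X : 'M[R]_(p, q).
Hypothesis GX : Gamma0 X.

Lemma Gamma0_ge0 i j : 0 <= X i j. Proof. by case: GX. Qed.
Lemma rowsum_gt0 i : 0 < rowsum X i. Proof. by case: GX. Qed.
Lemma colsum_gt0 j : 0 < colsum X j. Proof. by case: GX. Qed.

Lemma entry_le_rowsum i j : X i j <= rowsum X i.
Proof.
rewrite /rowsum (bigD1 j)//= lerDl sumr_ge0// => k _; exact: Gamma0_ge0.
Qed.

Lemma rowsum_le_total i : rowsum X i <= \sum_k rowsum X k.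
Proof.
rewrite [leRHS](bigD1 i)//= lerDl sumr_ge0// => k _.
exact/ltW/rowsum_gt0.
Qed.

Lemma rowratio_gt0 a : (forall i, 0 < a i) -> forall i, 0 < rowratio a X i.
Proof. by move=> a0 i; rewrite divr_gt0// rowsum_gt0. Qed.

Lemma colratio_gt0 b : (forall j, 0 < b j) -> forall j, 0 < colratio b X j.
Proof. by move=> b0 j; rewrite divr_gt0// colsum_gt0. Qed.

End positivity.

Lemma colsum_gt0_ex X j : 0 < colsum X j -> exists i, 0 < X i j.
Proof.
move=> h; apply/existsP; rewrite -[X in is_true X]negbK negb_exists.
apply/negP => /forallP n; move: h; apply/negP; rewrite -leNgt sumr_le0// => i _.
by rewrite leNgt n.
Qed.

Lemma rowsum_gt0_ex X i : 0 < rowsum X i -> exists j, 0 < X i j.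
Proof.
move=> h; apply/existsP; rewrite -[X in is_true X]negbK negb_exists.
apply/negP => /forallP n; move: h; apply/negP; rewrite -leNgt sumr_le0// => j _.
by rewrite leNgt n.
Qed.

Lemma Gamma0_Supp_sub X Y : Gamma0 X -> (forall i j, 0 <= Y i j) ->
  Supp X `<=` Supp Y -> Gamma0 Y.
Proof.
move=> GX Y0 XY; split=> // [i|j].
  have [j Xij] := rowsum_gt0_ex (rowsum_gt0 GX i).
  rewrite /rowsum (bigD1 j)//= ltr_pwDl//; first exact: (XY (i, j)).
  by rewrite sumr_ge0.
have [i Xij] := colsum_gt0_ex (colsum_gt0 GX j).
rewrite /colsum (bigD1 i)//= ltr_pwDl//; first exact: (XY (i, j)).
by rewrite sumr_ge0.
Qed.

Section targets.
Variables (a : 'I_p -> R) (b : 'I_q -> R).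
Hypotheses (a0 : forall i, 0 < a i) (b0 : forall j, 0 < b j).

Lemma T_R_gt0 X i j : Gamma0 X -> (0 < T_R a X i j) = (0 < X i j).
Proof. by move=> GX; rewrite mxE pmulr_lgt0// invr_gt0 rowratio_gt0. Qed.

Lemma T_C_gt0 X i j : Gamma0 X -> (0 < T_C b X i j) = (0 < X i j).
Proof. by move=> GX; rewrite mxE pmulr_lgt0// invr_gt0 colratio_gt0. Qed.

Lemma Gamma0_T_R X : Gamma0 X -> Gamma0 (T_R a X).
Proof.
move=> GX; apply: (Gamma0_Supp_sub GX) => [i j|[i j]].
  by rewrite mxE divr_ge0 ?(Gamma0_ge0 GX)// ltW// rowratio_gt0.
by rewrite /Supp /= T_R_gt0.
Qed.

Lemma Gamma0_T_C X : Gamma0 X -> Gamma0 (T_C b X).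
Proof.
move=> GX; apply: (Gamma0_Supp_sub GX) => [i j|[i j]].
  by rewrite mxE divr_ge0 ?(Gamma0_ge0 GX)// ltW// colratio_gt0.
by rewrite /Supp /= T_C_gt0.
Qed.

Lemma rowsum_T_R X i : Gamma0 X -> rowsum (T_R a X) i = a i.
Proof.
move=> GX; rewrite /rowsum; under eq_bigr do rewrite mxE.
rewrite -mulr_suml -/(rowsum X i) /rowratio invf_div mulrCA divff ?mulr1//.
by rewrite gt_eqF// rowsum_gt0.
Qed.

Lemma colsum_T_C X j : Gamma0 X -> colsum (T_C b X) j = b j.
Proof.
move=> GX; rewrite /colsum; under eq_bigr do rewrite mxE.
rewrite -mulr_suml -/(colsum X j) /colratio invf_div mulrCA divff ?mulr1//.
by rewrite gt_eqF// colsum_gt0.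
Qed.

Lemma colsumE X j : colsum X j = b j * colratio b X j.
Proof. by rewrite /colratio mulrCA divff ?mulr1// gt_eqF. Qed.

Lemma rowsumE X i : rowsum X i = a i * rowratio a X i.
Proof. by rewrite /rowratio mulrCA divff ?mulr1// gt_eqF. Qed.

Definition cross_entropy Z X : R := \sum_i \sum_j Z i j * ln (X i j).

(** A scaling step changes the logarithm of each entry by a function of its row
    only, so the change is seen through the marginals of [Z] alone. *)
Lemma cross_entropy_T_R Z X :
    Gamma0 X -> (forall i j, Z i j != 0 -> 0 < X i j) ->
  cross_entropy Z (T_R a X) =
  cross_entropy Z X - \sum_i rowsum Z i * ln (rowratio a X i).
Proof.
move=> GX ZX; rewrite -sum_rowsum -sumrB; apply: eq_bigr => i _.
rewrite -sumrB; apply: eq_bigr => j _.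
have [->|/ZX Xij] := eqVneq (Z i j) 0; first by rewrite !mul0r subr0.
by rewrite mxE ln_div ?mulrBr// posrE// rowratio_gt0.
Qed.

Lemma cross_entropy_T_C Z X :
    Gamma0 X -> (forall i j, Z i j != 0 -> 0 < X i j) ->
  cross_entropy Z (T_C b X) =
  cross_entropy Z X - \sum_j colsum Z j * ln (colratio b X j).
Proof.
move=> GX ZX; rewrite -sum_colsum -sumrB; apply: eq_bigr => i _.
rewrite -sumrB; apply: eq_bigr => j _.
have [->|/ZX Xij] := eqVneq (Z i j) 0; first by rewrite !mul0r subr0.
by rewrite mxE ln_div ?mulrBr// posrE// colratio_gt0.
Qed.

Lemma gibbs_mx Z (x y : 'I_p -> 'I_q -> R) :
    (forall i j, 0 <= Z i j) -> (forall i j, 0 < x i j) ->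
    (forall i j, 0 < y i j) ->
    \sum_i \sum_j Z i j * (y i j / x i j) <= \sum_i rowsum Z i ->
  \sum_i \sum_j Z i j * ln (y i j) <= \sum_i \sum_j Z i j * ln (x i j).
Proof.
move=> Z0 x0 y0; rewrite /rowsum !pair_big/= => h.
exact: (@gibbs R _ (fun k => Z k.1 k.2) (fun k => x k.1 k.2)
  (fun k => y k.1 k.2)).
Qed.

(** The relative entropy of [T_R a X] with respect to [X]. *)
Definition row_divergence X : R := - \sum_i a i * ln (rowratio a X i).
(** The relative entropy of [X] with respect to [T_C b X]: the roles are
    reversed compared with [row_divergence], so that in both cases the first
    argument is the iterate with row sums [a]. *)
Definition col_divergence X : R := \sum_j colsum X j * ln (colratio b X j).

(** [T_C b Y] minimises the relative entropy of [Y = T_R a X] with respect to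
    matrices with column sums [b], and [X] is one of them. *)
Lemma col_divergence_T_R X : Gamma0 X -> (forall j, colsum X j = b j) ->
  col_divergence (T_R a X) <= row_divergence X.
Proof.
move=> GX Xb; have GY := Gamma0_T_R GX.
have -> : row_divergence X =
    \sum_i \sum_j T_R a X i j * ln ((rowratio a X i)^-1).
  rewrite sum_rowsum /row_divergence -sumrN; apply: eq_bigr => i _.
  by rewrite rowsum_T_R// lnV ?posrE ?rowratio_gt0// mulrN.
rewrite /col_divergence -sum_colsum.
apply: (@gibbs_mx (T_R a X) (fun i _ => (rowratio a X i)^-1)
  (fun _ j => colratio b (T_R a X) j)) => [i j|i j|i j|].
- exact: (Gamma0_ge0 GY).
- by rewrite invr_gt0 rowratio_gt0.
- exact: colratio_gt0.
rewrite -total_colsum.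
under eq_bigr => i _ do under eq_bigr => j _ do
  rewrite invrK mulrCA mulrC mxE divfK ?gt_eqF ?rowratio_gt0//.
rewrite sum_colsum; apply: ler_sum => j _.
by rewrite Xb -colsumE.
Qed.

(** [T_R a Z] minimises relative entropy with respect to [Z = T_C b X] among the
    matrices with row sums [a], and [X] is one of them. *)
Lemma row_divergence_T_C X : Gamma0 X -> (forall i, rowsum X i = a i) ->
  row_divergence (T_C b X) <= col_divergence X.
Proof.
move=> GX Xa; have GY := Gamma0_T_C GX.
have -> : row_divergence (T_C b X) =
    \sum_i \sum_j X i j * ln ((rowratio a (T_C b X) i)^-1).
  rewrite sum_rowsum /row_divergence -sumrN; apply: eq_bigr => i _.
  by rewrite Xa lnV ?posrE ?rowratio_gt0// mulrN.
rewrite /col_divergence -sum_colsum.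
apply: (@gibbs_mx X (fun _ j => colratio b X j)
  (fun i _ => (rowratio a (T_C b X) i)^-1)) => [i j|i j|i j|].
- exact: (Gamma0_ge0 GX).
- exact: colratio_gt0.
- by rewrite invr_gt0 rowratio_gt0.
rewrite [leRHS](eq_bigr _ (fun i _ => Xa i)).
rewrite -[leRHS](eq_bigr _ (fun i _ => rowsum_T_R i GY)).
apply: ler_sum => i _; apply: ler_sum => j _.
by rewrite !mxE mulrA [leLHS]mulrAC.
Qed.

End targets.
End scaling.

(** * Limits of marginals, entropies and scaled matrices *)

Section limits.
Context {R : realType} {T : Type} {F : set_system T}.

Lemma ultra_cvg_bounded (f : T -> R) : UltraFilter F ->
  (forall t, 0 <= f t <= 1) -> exists l : R, f @ F --> l.
Proof.
move=> FU f01.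
have : compact `[0 : R, 1] by exact: segment_compact.
move=> /(_ (f @ F) _) [].
  by apply: (@filterE _ F _ (f @^-1` _)) => t; rewrite /= in_itv /= f01.
move=> l [_ fl]; exists l => A lA.
have [//|FnA] := in_ultra_setVsetC (f @^-1` A) FU.
by have [t []] := fl (~` A) A FnA lA.
Qed.

Lemma cvg_of_sqr {FF : Filter F} (f : T -> R) (l : R) :
  (f t - l) ^+ 2 @[t --> F] --> (0 : R) -> f @ F --> l.
Proof.
move=> h; apply: (@cvg_zero R R^o); apply: norm_cvg0.
have -> : (fun t => `|(f - cst l) t|) = fun t => Num.sqrt ((f t - l) ^+ 2).
  by apply/funext => t; rewrite sqrtr_sqr.
by rewrite -(@sqrtr0 R); apply: (cvg_comp _ _ h); exact: sqrt_continuous.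
Qed.

Context {FF : Filter F} {p q : nat}.
Implicit Types (a : 'I_p -> R) (b : 'I_q -> R).

Lemma cvg_sum_ord n (f : 'I_n -> T -> R) (l : 'I_n -> R) :
  (forall i, f i @ F --> l i) -> \sum_i f i t @[t --> F] --> \sum_i l i.
Proof. by move=> fl; apply: cvg_big => //; exact: add_continuous. Qed.

Variables (X : T -> 'M[R]_(p, q)) (P : 'M[R]_(p, q)).
Hypothesis XP : forall i j, X t i j @[t --> F] --> P i j.

Lemma cvg_rowratio a i : rowratio a (X t) i @[t --> F] --> rowratio a P i.
Proof. by apply: cvgMl; apply: cvg_sum_ord => j; exact: XP. Qed.

Lemma cvg_colsum j : colsum (X t) j @[t --> F] --> colsum P j.
Proof. by apply: cvg_sum_ord => i; exact: XP. Qed.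

Lemma cvg_colratio b j : colratio b (X t) j @[t --> F] --> colratio b P j.
Proof. by apply: cvgMl; exact: cvg_colsum. Qed.

Lemma cvg_ln (f : T -> R) (l : R) :
  0 < l -> f @ F --> l -> ln (f t) @[t --> F] --> ln l.
Proof. by move=> l0 fl; apply: (cvg_comp _ _ fl); exact: continuous_ln. Qed.

Lemma cvg_cross_entropy (Z : 'M[R]_(p, q)) :
    (forall i j, Z i j != 0 -> 0 < P i j) ->
  cross_entropy Z (X t) @[t --> F] --> cross_entropy Z P.
Proof.
move=> ZP; apply: cvg_sum_ord => i; apply: cvg_sum_ord => j.
have [->|/ZP Pij] := eqVneq (Z i j) 0.
  under eq_fun do rewrite mul0r; rewrite mul0r; exact: cvg_cst.
by apply: cvgMr; exact: cvg_ln.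
Qed.

Lemma cvg_col_divergence b : (forall j, 0 < colratio b P j) ->
  col_divergence b (X t) @[t --> F] --> col_divergence b P.
Proof.
move=> P0; apply: cvg_sum_ord => j; apply: cvgM; first exact: cvg_colsum.
by apply: cvg_ln => //; exact: cvg_colratio.
Qed.

Lemma cvg_T_R a i j : 0 < rowratio a P i ->
  T_R a (X t) i j @[t --> F] --> T_R a P i j.
Proof.
move=> P0; rewrite mxE; under eq_fun do rewrite mxE.
by apply: cvgM => //; apply: cvgV; rewrite ?gt_eqF//; exact: cvg_rowratio.
Qed.

Lemma cvg_T_C b i j : 0 < colratio b P j ->
  T_C b (X t) i j @[t --> F] --> T_C b P i j.
Proof.
move=> P0; rewrite mxE; under eq_fun do rewrite mxE.
by apply: cvgM => //; apply: cvgV; rewrite ?gt_eqF//; exact: cvg_colratio.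
Qed.

End limits.

Lemma cvg_real_unique {R : realType} {T : Type} {F : set_system T}
  {FF : ProperFilter F} (f : T -> R) (l l' : R) :
  f @ F --> l -> f @ F --> l' -> l = l'.
Proof. exact: cvg_unique. Qed.

(** * Convergence of the procedure *)

Section iteration.
Context {R : realType} {p q : nat}.
Variables (a : 'I_p -> R) (b : 'I_q -> R).
Hypotheses (a0 : forall i, 0 < a i) (b0 : forall j, 0 < b j).
Hypotheses (a1 : \sum_i a i = 1) (b1 : \sum_j b j = 1).
Implicit Types X S : 'M[R]_(p, q).

Lemma ipfp_odd X n : ipfp a b X n.*2.+1 = T_R a (ipfp a b X n.*2).
Proof. by rewrite /= odd_double. Qed.

Lemma ipfp_even X n : ipfp a b X n.+1.*2 = T_C b (ipfp a b X n.*2.+1).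
Proof. by rewrite doubleS /= odd_double. Qed.

Lemma ipfp_shift2 X n : ipfp a b (ipfp a b X 2) n = ipfp a b X n.+2.
Proof. by elim: n => // n IH; rewrite [LHS]/= IH /= negbK. Qed.

Lemma Gamma0_ipfp X n : Gamma0 X -> Gamma0 (ipfp a b X n).
Proof.
move=> GX; elim: n => //= n IH.
by case: ifP => _; [exact: Gamma0_T_C|exact: Gamma0_T_R].
Qed.

Lemma ipfp_gt0 X n i j : Gamma0 X -> (0 < ipfp a b X n i j) = (0 < X i j).
Proof.
move=> GX; elim: n => //= n <-.
by case: ifP => _; rewrite ?T_C_gt0 ?T_R_gt0//; exact: Gamma0_ipfp.
Qed.

Lemma rowsum_ipfp_odd X n i : Gamma0 X -> rowsum (ipfp a b X n.*2.+1) i = a i.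
Proof. by move=> GX; rewrite ipfp_odd rowsum_T_R//; exact: Gamma0_ipfp. Qed.

(** A start with column sums [b] makes even and odd steps symmetric, so that the
    two divergences interlace from the very first step. *)
Section aligned_columns.
Variable X : 'M[R]_(p, q).
Hypotheses (GX : Gamma0 X) (Xb : forall j, colsum X j = b j).
Let x := ipfp a b X.

Let Gx n : Gamma0 (x n). Proof. exact: Gamma0_ipfp. Qed.

Lemma colsum_ipfp_even n j : colsum (x n.*2) j = b j.
Proof. by case: n => // n; rewrite /x ipfp_even colsum_T_C//; exact: Gx. Qed.

Lemma total_ipfp_even n : \sum_i rowsum (x n.*2) i = 1.
Proof.
by rewrite -total_colsum; under eq_bigr do rewrite colsum_ipfp_even.
Qed.

Lemma total_ipfp_odd n : \sum_i rowsum (x n.*2.+1) i = 1.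
Proof. by under eq_bigr do rewrite rowsum_ipfp_odd//. Qed.

Lemma ipfp_even_le1 n i j : x n.*2 i j <= 1.
Proof.
apply: le_trans (entry_le_rowsum (Gx _) i j) _.
by rewrite -(total_ipfp_even n) rowsum_le_total.
Qed.

Lemma ipfp_odd_le1 n i j : x n.*2.+1 i j <= 1.
Proof.
apply: le_trans (entry_le_rowsum (Gx _) i j) _.
by rewrite -(total_ipfp_odd n) rowsum_le_total.
Qed.

(** A row ratio of an even iterate is at most [1 / a i], as the total mass is 1,
    so an odd iterate keeps at least the fraction [min a] of each column sum.
    This is what keeps limits of column ratios positive. *)
Lemma colratio_ipfp_ge : exists2 m, 0 < m &
  forall n j, m <= colratio b (x n.*2.+1) j.
Proof.
exists (\big[Num.min/1]_i a i); first by apply: lt_bigmin.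
set m := \big[_/_]_i _ => n j.
have ma i : m <= a i by exact: bigmin_le.
have xE i : m * x n.*2 i j <= x n.*2.+1 i j.
  rewrite /x ipfp_odd mxE -/x mulrC ler_wpM2l//.
    exact: (Gamma0_ge0 (Gx _)).
  apply: le_trans (ma i) _; rewrite /rowratio invf_div ler_pdivlMr ?rowsum_gt0//.
  rewrite ler_piMr//; first exact: ltW.
  by rewrite -(total_ipfp_even n) rowsum_le_total.
rewrite /colratio ler_pdivlMr// -(colsum_ipfp_even n) mulr_sumr.
by apply: ler_sum => i _; exact: xE.
Qed.

Let A n := row_divergence a (x n.*2).
Let B n := col_divergence b (x n.*2.+1).

Let BA n : B n <= A n.
Proof.
rewrite /A /B /x ipfp_odd; apply: col_divergence_T_R => // j.
exact: colsum_ipfp_even.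
Qed.

Let AB n : A n.+1 <= B n.
Proof.
rewrite /A /B /x ipfp_even; apply: row_divergence_T_C => // i.
exact: rowsum_ipfp_odd.
Qed.

Lemma cross_entropy_odd S n : (forall i, rowsum S i = a i) ->
    (forall i j, S i j != 0 -> 0 < X i j) ->
  cross_entropy S (x n.*2.+1) = cross_entropy S (x n.*2) + A n.
Proof.
move=> Sa SX; rewrite /x ipfp_odd cross_entropy_T_R//; last first.
  by move=> i j /SX; rewrite ipfp_gt0.
by congr (_ - _); apply: eq_bigr => i _; rewrite Sa.
Qed.

(** With column sums [b * g] for [S], Gibbs' inequality bounds the loss at the
    column step by the sum of [b * g * ln g], which the gain [A n] at the row step
    compensates. *)
Lemma cross_entropy_even_le S (g : 'I_q -> R) n : (forall j, 0 < g j) ->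
    (forall i, rowsum S i = a i) -> (forall j, colsum S j = b j * g j) ->
    (forall i j, S i j != 0 -> 0 < X i j) ->
    \sum_j b j * g j * ln (g j) <= A n ->
  cross_entropy S (x n.*2) <= cross_entropy S (x n.+1.*2).
Proof.
move=> g0 Sa Sb SX dA.
rewrite /x ipfp_even cross_entropy_T_C//; last first.
  by move=> i j /SX; rewrite ipfp_gt0.
rewrite -/x cross_entropy_odd// -addrA lerDl subr_ge0; apply: le_trans dA.
under eq_bigr do rewrite Sb.
apply: gibbs => // [j|j|].
- by rewrite mulr_ge0// ltW.
- by apply: colratio_gt0.
have -> : \sum_j b j * g j = 1.
  by rewrite -(eq_bigr _ (fun j _ => Sb j)) total_colsum;
     under eq_bigr do rewrite Sa.
under eq_bigr => j _ do
  rewrite -mulrA [g j * _]mulrC divfK ?(gt_eqF (g0 j))// -colsumE//.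
by rewrite total_colsum total_ipfp_odd.
Qed.

(** The limit [P] is first obtained along an ultrafilter, where nothing but
    boundedness is needed; monotonicity of the cross entropy of [P] itself then
    turns it into a limit of the whole sequence. *)
Lemma ipfp_odd_cvg : exists P : 'M[R]_(p, q), [/\
    forall i j, x n.*2.+1 i j @[n --> \oo] --> P i j,
  forall j, 0 < colratio b P j & forall n, col_divergence b P <= A n].
Proof.
have [U [UU oU]] := ultraFilterLemma eventually_filter.
have x01 i j n : 0 <= x n.*2.+1 i j <= 1.
  by rewrite (Gamma0_ge0 (Gx _)) ipfp_odd_le1.
have /choice[P0 xP0] : forall ij : 'I_p * 'I_q,
    exists l : R, x n.*2.+1 ij.1 ij.2 @[n --> U] --> l.
  by move=> ij; exact: ultra_cvg_bounded.
pose P : 'M[R]_(p, q) := \matrix_(i, j) P0 (i, j).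
have xP i j : x n.*2.+1 i j @[n --> U] --> P i j.
  by rewrite mxE; exact: xP0 (i, j).
have P_ge0 i j : 0 <= P i j.
  by apply: (cvgr_to_ge (xP i j)); apply: nearW => n; case/andP: (x01 i j n).
have Pa i : rowsum P i = a i.
  have h : rowratio a (x n.*2.+1) i @[n --> U] --> rowratio a P i.
    exact: cvg_rowratio.
  have : (fun n => rowratio a (x n.*2.+1) i) @ U --> (1 : R).
    under eq_fun => n do rewrite /rowratio rowsum_ipfp_odd// divff ?gt_eqF//.
    exact: cvg_cst.
  move=> /(cvg_real_unique h) hE; rewrite (rowsumE a0) hE mulr1 //.
have Pt : \sum_i rowsum P i = 1 by under eq_bigr do rewrite Pa.
have [m m0 mx] := colratio_ipfp_ge.
have P_C j : 0 < colratio b P j.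
  apply: (lt_le_trans m0); apply: (cvgr_to_ge (cvg_colratio (b := b) (j := j) xP)).
  by apply: nearW => n; exact: mx.
(* The divergences decrease along the whole sequence, so their limit along the
   finer filter is a lower bound. *)
have dB n : col_divergence b P <= B n.
  apply: (cvgr_to_le (cvg_col_divergence xP P_C)); apply: oU.
  exists n => // k /= nk; rewrite -/(B k).
  elim: k nk => [|k IH]; first by rewrite leqn0 => /eqP ->.
  rewrite leq_eqVlt => /orP[/eqP->//|]; rewrite ltnS => /IH; apply: le_trans.
  exact: le_trans (BA _) (AB _).
have dA n : col_divergence b P <= A n := le_trans (dB n) (BA n).
have PX i j : P i j != 0 -> 0 < X i j.
  apply: contraTT; rewrite -leNgt => Xij; rewrite negbK; apply/eqP.
  apply: (cvg_real_unique (xP i j)).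
  suff -> : (fun n => x n.*2.+1 i j) = cst 0 by exact: cvg_cst.
  apply/funext => n; apply/eqP; rewrite eq_le -[_ <= 0]negbK -ltNge ipfp_gt0//.
  by rewrite -leNgt Xij (Gamma0_ge0 (Gx _)).
have ce_nd : nondecreasing_seq (fun n => cross_entropy P (x n.*2)).
  apply/nondecreasing_seqP => n.
  apply: (cross_entropy_even_le P_C) => // [j|]; first by rewrite -colsumE.
  by under eq_bigr do rewrite -colsumE//; exact: dA.
have ce_le0 n : cross_entropy P (x n.*2) <= 0.
  apply: sumr_le0 => i _; apply: sumr_le0 => j _.
  by rewrite mulr_ge0_le0 ?ln_le0 ?ipfp_even_le1.
have ce_even : cvgn (fun n => cross_entropy P (x n.*2)).
  by apply: nondecreasing_is_cvgn => //; exists 0 => _ [n _ <-].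
have cA : cvgn A.
  apply: nonincreasing_is_cvgn; last by exists (col_divergence b P) => _ [n _ <-].
  by apply/nonincreasing_seqP => n; exact: le_trans (AB _) (BA _).
(* The cross entropy converges along the full sequence; only the value of its
   limit is read off the ultrafilter. *)
have ce_odd : (fun n => cross_entropy P (x n.*2.+1)) @ \oo --> cross_entropy P P.
  have h : cvgn (fun n => cross_entropy P (x n.*2.+1)).
    under eq_fun => n do rewrite cross_entropy_odd//.
    exact: is_cvgD.
  have := h; move/cvg_ex => [l hl].
  suff -> : cross_entropy P P = l by [].
  have := cvg_trans (cvg_app _ oU) hl.
  apply: cvg_real_unique; apply: cvg_cross_entropy => // i j Pij.
  by rewrite lt_neqAle eq_sym Pij P_ge0.
exists P; split => // i j.
have sq_le n : (Num.sqrt (x n.*2.+1 i j) - Num.sqrt (P i j)) ^+ 2 <=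
    cross_entropy P P - cross_entropy P (x n.*2.+1).
  pose h k l := (Num.sqrt (x n.*2.+1 k l) - Num.sqrt (P k l)) ^+ 2.
  have h0 k l : 0 <= h k l by exact: sqr_ge0.
  have : h i j <= \sum_k \sum_l h k l.
    rewrite (bigD1 i)//= (bigD1 j)//= -addrA lerDl addr_ge0// sumr_ge0// => k _.
    by rewrite sumr_ge0.
  move/le_trans; apply.
  (* Both matrices have mass 1: adding the difference of the masses produces the
     termwise Hellinger bound. *)
  have -> : cross_entropy P P - cross_entropy P (x n.*2.+1) = cross_entropy P P -
      cross_entropy P (x n.*2.+1) + (\sum_k rowsum (x n.*2.+1) k -
      \sum_k rowsum P k) by rewrite Pt total_ipfp_odd subrr addr0.
  rewrite -!sumrB -big_split /=; apply: ler_sum => k _.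
  rewrite -!sumrB -big_split /=; apply: ler_sum => l _.
  apply: hellinger_le_entropy_term => [//||Pkl]; first by case/andP: (x01 k l n).
  by rewrite ipfp_gt0// PX// gt_eqF.
have sq0 : (Num.sqrt (x n.*2.+1 i j) - Num.sqrt (P i j)) ^+ 2 @[n --> \oo] -->
    (0 : R).
  apply: (@squeeze_cvgr _ _ _ _ (cst 0)
    (fun n => cross_entropy P P - cross_entropy P (x n.*2.+1))).
  - by apply: nearW => n; rewrite sq_le sqr_ge0.
  - exact: cvg_cst.
  - by rewrite -(subrr (cross_entropy P P)); apply: cvgB => //; exact: cvg_cst.
have sqrtP : Num.sqrt (x n.*2.+1 i j) @[n --> \oo] --> Num.sqrt (P i j).
  exact: cvg_of_sqr.
rewrite -[X in _ --> X](sqr_sqrtr (P_ge0 i j)) expr2.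
under eq_fun => n do
  rewrite -[x _ _ _](@sqr_sqrtr _ _ (proj1 (andP (x01 i j n)))) expr2.
exact: cvgM.
Qed.

End aligned_columns.
End iteration.

(** * The pair of limits and its maximality *)

Section limit_pair.
Context {R : realType} {p q : nat}.
Variables (a : 'I_p -> R) (b : 'I_q -> R).
Hypotheses (a0 : forall i, 0 < a i) (b0 : forall j, 0 < b j).
Hypotheses (a1 : \sum_i a i = 1) (b1 : \sum_j b j = 1).
Implicit Types X P Q S : 'M[R]_(p, q).

(** [P] is the limit of the odd iterates and [Q] that of the even ones.  The
    last field is part of the record because it is read off the same monotone
    cross entropy that gives convergence; what is said later about supports and
    restriction only relies on these seven facts. *)
Record ipfp_limits X P Q : Prop := IpfpLimits {
  limits_Gamma0_odd : Gamma0 P;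
  limits_Gamma0_even : Gamma0 Q;
  limits_T_R : P = T_R a Q;
  limits_T_C : Q = T_C b P;
  limits_odd : forall i j, ipfp a b X n.*2.+1 i j @[n --> \oo] --> P i j;
  limits_even : forall i j, ipfp a b X n.*2 i j @[n --> \oo] --> Q i j;
  limits_maximal : forall S, Gamma_in a (colsum P) X S -> Supp S `<=` Supp P
}.

Lemma neq0_Supp_sub S X : (forall i j, 0 <= S i j) -> Supp S `<=` Supp X ->
  forall i j, S i j != 0 -> 0 < X i j.
Proof.
by move=> S0 SX i j Sij; apply: (SX (i, j)); rewrite /Supp /= lt0r Sij S0.
Qed.

Lemma ipfp_limits_aligned X : Gamma0 X -> (forall j, colsum X j = b j) ->
  exists P Q, ipfp_limits X P Q.
Proof.
move=> GX Xb.
have Gx n : Gamma0 (ipfp a b X n) by exact: Gamma0_ipfp.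
have [P [xP P_C dA]] := ipfp_odd_cvg a0 b0 a1 b1 GX Xb.
have P_ge0 i j : 0 <= P i j.
  apply: (cvgr_to_ge (xP i j)); apply: nearW => n; exact: (Gamma0_ge0 (Gx _)).
have Pa i : rowsum P i = a i.
  have h : rowratio a (ipfp a b X n.*2.+1) i @[n --> \oo] --> rowratio a P i.
    exact: cvg_rowratio.
  rewrite (rowsumE a0) -[RHS]mulr1; congr (_ * _).
  apply: (cvg_real_unique h).
  under eq_fun => n do rewrite /rowratio rowsum_ipfp_odd// divff ?gt_eqF//.
  exact: cvg_cst.
have GP : Gamma0 P.
  split => // [i|j]; first by rewrite Pa.
  by rewrite (colsumE b0) mulr_gt0.
have xQ i j : ipfp a b X n.*2 i j @[n --> \oo] --> T_C b P i j.
  rewrite -(cvg_shiftS (fun n => ipfp a b X n.*2 i j)).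
  have -> : [sequence ipfp a b X n.+1.*2 i j]_n =
      fun n => T_C b (ipfp a b X n.*2.+1) i j.
    by apply/funext => n; rewrite -ipfp_even.
  exact: cvg_T_C.
have GQ : Gamma0 (T_C b P) by exact: Gamma0_T_C.
exists P, (T_C b P); split => //.
  apply/matrixP => i j; apply: (cvg_real_unique (xP i j)).
  under eq_fun => n do rewrite ipfp_odd.
  by apply: cvg_T_R => //; exact: rowratio_gt0.
move=> S [[[S0 _ _] Sa Sb] SX] [i j] /= Sij.
have ce_le n : cross_entropy S X <= cross_entropy S (ipfp a b X n.*2).
  elim: n => // n IH; apply: le_trans IH _.
  apply: (cross_entropy_even_le a0 b0 a1 GX P_C Sa) => [k||].
  - by rewrite -colsumE// -Sb.
  - exact: neq0_Supp_sub.
  - by under eq_bigr do rewrite -colsumE//; exact: dA.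
rewrite /Supp /= -(T_C_gt0 b0 i j GP).
(* All terms of the cross entropy are nonpositive, so the term at (i, j) alone is
   at least the initial value: the even iterates stay above this constant. *)
apply: (lt_le_trans (expR_gt0 (cross_entropy S X / S i j))).
apply: (cvgr_to_ge (xQ i j)); apply: nearW => n.
have xij : 0 < ipfp a b X n.*2 i j by rewrite ipfp_gt0//; exact: (SX (i, j)).
rewrite -[leRHS]lnK ?posrE// ler_expR ler_pdivrMr// mulrC.
apply: le_trans (ce_le n) _; rewrite /cross_entropy.
have t0 k l : S k l * ln (ipfp a b X n.*2 k l) <= 0.
  by rewrite mulr_ge0_le0// ln_le0// (ipfp_even_le1 a0 b0 b1 GX Xb).
rewrite (bigD1 i)//= (bigD1 j)//= -addrA gerDl.
by rewrite -[leRHS](addr0 0) lerD// sumr_le0// => k _; rewrite sumr_le0.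
Qed.

(** Two steps bring the column sums to [b] without changing the support. *)
Lemma ipfp_limits_exist X : Gamma0 X -> exists P Q, ipfp_limits X P Q.
Proof.
move=> GX; pose X2 := ipfp a b X 2.
have GX2 : Gamma0 X2 by exact: Gamma0_ipfp.
have X2b j : colsum X2 j = b j.
  have -> : X2 = T_C b (ipfp a b X 1) by [].
  by rewrite colsum_T_C//; exact: Gamma0_ipfp.
have [P [Q [GP GQ PQ QP xP xQ Pmax]]] := ipfp_limits_aligned GX2 X2b.
exists P, Q; split=> // [i j|i j|S [GS SX]].
- rewrite -(cvg_shiftS (fun n => ipfp a b X n.*2.+1 i j)) /=.
  by move: (xP i j); under eq_fun => n do rewrite ipfp_shift2.
- rewrite -(cvg_shiftS (fun n => ipfp a b X n.*2 i j)) /=.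
  by move: (xQ i j); under eq_fun => n do rewrite ipfp_shift2.
- apply: Pmax; split=> // -[i j] /SX; rewrite /Supp /= ipfp_gt0//.
Qed.

Lemma sum_add_potentials S (f : 'I_p -> R) (g : 'I_q -> R) :
  \sum_i \sum_j S i j * (f i + g j) =
  \sum_i rowsum S i * f i + \sum_j colsum S j * g j.
Proof.
rewrite -sum_rowsum -sum_colsum -big_split; apply: eq_bigr => i _.
by rewrite -big_split; apply: eq_bigr => j _; exact: mulrDr.
Qed.

Section fixed_limits.
Variables X P Q : 'M[R]_(p, q).
Hypotheses (GX : Gamma0 X) (L : ipfp_limits X P Q).
Let GP := limits_Gamma0_odd L.
Let GQ := limits_Gamma0_even L.
Let rho := rowratio a Q.
Let gam := colratio b P.

Let rho0 i : 0 < rho i. Proof. exact: rowratio_gt0. Qed.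
Let gam0 j : 0 < gam j. Proof. exact: colratio_gt0. Qed.

Lemma limits_supp_eq i j : (0 < Q i j) = (0 < P i j).
Proof. by rewrite (limits_T_C L) T_C_gt0. Qed.

Lemma limits_rowsum i : rowsum P i = a i.
Proof. by rewrite (limits_T_R L) rowsum_T_R. Qed.

Lemma limits_colsum j : colsum Q j = b j.
Proof. by rewrite (limits_T_C L) colsum_T_C. Qed.

Lemma limits_total : \sum_j colsum P j = 1.
Proof. by rewrite total_colsum; under eq_bigr do rewrite limits_rowsum. Qed.

Lemma limits_supp_sub i j : 0 < P i j -> 0 < X i j.
Proof.
apply: contraTT; rewrite -!leNgt => Xij.
suff -> : P i j = 0 by [].
apply: (cvg_real_unique (limits_odd L (i := i) (j := j))).
suff -> : (fun n => ipfp a b X n.*2.+1 i j) = cst 0 by exact: cvg_cst.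
apply/funext => n; apply/eqP; rewrite eq_le -[_ <= 0]negbK -ltNge ipfp_gt0//.
by rewrite -leNgt Xij (Gamma0_ge0 (Gamma0_ipfp a0 b0 _ GX)).
Qed.

Lemma limits_ratio_eq1 i j : 0 < P i j -> rho i * gam j = 1.
Proof.
move=> Pij; have P_neq0 : P i j != 0 by rewrite gt_eqF.
have := limits_T_R L; move=> /matrixP/(_ i j); rewrite mxE -/(rho i) => PE.
have := limits_T_C L; move=> /matrixP/(_ i j); rewrite mxE -/(gam j) => QE.
apply: (mulfI P_neq0); rewrite mulr1 {1}PE QE mulrA divfK ?gt_eqF//.
by rewrite divfK// gt_eqF.
Qed.

(** If the product were less than 1, the even iterates would eventually increase
    at this entry, hence have a positive limit there; but on the support of the
    limit the product is 1. *)
Lemma limits_ratio_ge1 i j : 0 < X i j -> 1 <= rho i * gam j.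
Proof.
move=> Xij; rewrite leNgt; apply/negP => lt1.
pose x := ipfp a b X.
have xpos n : 0 < x n i j by rewrite ipfp_gt0.
have Gx n : Gamma0 (x n) by exact: Gamma0_ipfp.
have cRC : rowratio a (x n.*2) i * colratio b (x n.*2.+1) j @[n --> \oo] -->
    rho i * gam j.
  apply: cvgM; first by apply: cvg_rowratio => k l; exact: (limits_even L).
  by apply: cvg_colratio => k l; exact: (limits_odd L).
have [N _ HN] : \forall n \near \oo,
    rowratio a (x n.*2) i * colratio b (x n.*2.+1) j < 1.
  exact: (cvgr_lt _ cRC).
have le_next n : (N <= n)%N -> x n.*2 i j <= x n.+1.*2 i j.
  move=> Nn; have lt := HN n Nn.
  rewrite {2}/x ipfp_even mxE ipfp_odd mxE -ipfp_odd -/x.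
  have R0 : 0 < rowratio a (x n.*2) i by exact: rowratio_gt0.
  have C0 : 0 < colratio b (x n.*2.+1) j by exact: colratio_gt0.
  rewrite ler_pdivlMr// ler_pdivlMr// -mulrA [_ * rowratio _ _ _]mulrC.
  by rewrite ler_piMr ?ltW.
have : 0 < Q i j.
  apply: (lt_le_trans (xpos N.*2)).
  apply: (cvgr_to_ge (limits_even L (i := i) (j := j))).
  exists N => // n /= /subnK <-; elim: (n - N)%N => // k IH.
  by apply: le_trans IH _; rewrite addSn le_next// leq_addl.
rewrite limits_supp_eq => /limits_ratio_eq1 E.
by rewrite E ltxx in lt1.
Qed.

Lemma limits_even_in : Gamma_in (rowsum Q) b X Q.
Proof.
split; first by split=> //; exact: limits_colsum.
by move=> [i j] /=; rewrite /Supp /= limits_supp_eq; exact: limits_supp_sub.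
Qed.

(** The column sums of the rescaled matrix are at most those of [P] since
    [1 / rho i <= gam j] on the support of [X]; both have total mass 1, so they
    agree. *)
Lemma Gamma_in_rescale S : Gamma_in (rowsum Q) b X S ->
  Gamma_in a (colsum P) X (\matrix_(i, j) (S i j / rho i)).
Proof.
move=> [[GS Sa Sb] SX]; set S' := \matrix_(i, j) _.
have S0 := Gamma0_ge0 GS.
have S'pos i j : (0 < S' i j) = (0 < S i j).
  by rewrite mxE pmulr_lgt0// invr_gt0.
have GS' : Gamma0 S'.
  apply: (Gamma0_Supp_sub GS) => [i j|[i j]]; last by rewrite /Supp /= S'pos.
  by rewrite mxE divr_ge0// ltW.
have S'a i : rowsum S' i = a i.
  rewrite /rowsum; under eq_bigr do rewrite mxE.
  by rewrite -mulr_suml -/(rowsum S i) Sa (rowsumE a0) mulfK// gt_eqF.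
have S'le j : colsum S' j <= colsum P j.
  rewrite [leRHS](colsumE b0) -/(gam j) -Sb mulr_suml; apply: ler_sum => i _.
  rewrite mxE ler_pdivrMr//; have [Sij|] := ltP 0 (S i j); last first.
    move=> Sij; have -> : S i j = 0 by apply/eqP; rewrite eq_le Sij S0.
    by rewrite !mul0r.
  by rewrite -mulrA ler_peMr// mulrC limits_ratio_ge1//; exact: (SX (i, j)).
split; last by move=> [i j]; rewrite /Supp /= S'pos; exact: (SX (i, j)).
split=> // j; apply/eqP; rewrite eq_sym -subr_eq0; apply/eqP.
apply: (psumr_eq0P (P := predT) (F := fun j => colsum P j - colsum S' j)) => //.
- by move=> k _; rewrite subr_ge0.
- rewrite sumrB limits_total total_colsum.
  under [X in _ - X]eq_bigr do rewrite S'a.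
  by rewrite a1 subrr.
Qed.

Lemma limits_support :
  Supp Q = \bigcup_(S in Gamma_in (rowsum Q) b X `|` Gamma_in a (colsum P) X)
    Supp S.
Proof.
apply/seteqP; split=> [ij Qij|[i j] [S [SQ|SP] Sij]].
- by exists Q => //; left; exact: limits_even_in.
- rewrite /Supp /= limits_supp_eq; change (Supp P (i, j)).
  apply: (limits_maximal L (Gamma_in_rescale SQ)).
  by rewrite /Supp /= mxE divr_gt0.
- rewrite /Supp /= limits_supp_eq; change (Supp P (i, j)).
  exact: (limits_maximal L SP).
Qed.

(** A matrix with zero marginals does not see row and column scalings: this is
    the conserved quantity of the procedure, and it survives in the limit. *)
Lemma cross_entropy_ipfp S n : (forall i, rowsum S i = 0) ->
    (forall j, colsum S j = 0) -> (forall i j, S i j != 0 -> 0 < X i j) ->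
  cross_entropy S (ipfp a b X n) = cross_entropy S X.
Proof.
move=> Sr Sc SX; elim: n => // n <-.
have Sx i j : S i j != 0 -> 0 < ipfp a b X n i j by move/SX; rewrite ipfp_gt0.
have Gx : Gamma0 (ipfp a b X n) by exact: Gamma0_ipfp.
rewrite /=; case: ifP => _.
  rewrite cross_entropy_T_C// big1 ?subr0// => j _; by rewrite Sc mul0r.
rewrite cross_entropy_T_R// big1 ?subr0// => i _; by rewrite Sr mul0r.
Qed.

Lemma cross_entropy_limit S : (forall i, rowsum S i = 0) ->
    (forall j, colsum S j = 0) -> (forall i j, S i j != 0 -> 0 < P i j) ->
  cross_entropy S P = cross_entropy S X.
Proof.
move=> Sr Sc SP.
have h : cross_entropy S (ipfp a b X n.*2.+1) @[n --> \oo] --> cross_entropy S P.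
  by apply: cvg_cross_entropy => // i j; exact: (limits_odd L).
have SX i j : S i j != 0 -> 0 < X i j by move=> /SP; exact: limits_supp_sub.
apply: (cvg_real_unique h); under eq_fun do rewrite cross_entropy_ipfp//.
exact: cvg_cst.
Qed.

(** The logarithm of [rho i * gam j] vanishes on the support of [P]; summing it
    against [S] leaves only the marginals of [S]. *)
Lemma sum_ln_ratio S : (forall i, rowsum S i = a i) ->
    (forall i j, S i j != 0 -> 0 < P i j) ->
  \sum_i a i * ln (rho i) + \sum_j colsum S j * ln (gam j) = 0.
Proof.
move=> Sa SP; rewrite -(eq_bigr _ (fun i _ => congr1 (fun t => t * _) (Sa i))).
rewrite -sum_add_potentials big1// => i _; rewrite big1// => j _.
have [->|/SP Pij] := eqVneq (S i j) 0; first by rewrite mul0r.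
by rewrite -lnM ?posrE// limits_ratio_eq1// ln1 mulr0.
Qed.

Lemma sum_ln_ratio_ge0 S : (forall i, rowsum S i = a i) ->
    (forall i j, 0 <= S i j) -> (forall i j, S i j != 0 -> 0 < X i j) ->
  0 <= \sum_i a i * ln (rho i) + \sum_j colsum S j * ln (gam j).
Proof.
move=> Sa S0 SX; rewrite -(eq_bigr _ (fun i _ => congr1 (fun t => t * _) (Sa i))).
rewrite -sum_add_potentials sumr_ge0// => i _; rewrite sumr_ge0// => j _.
have [->|/SX Xij] := eqVneq (S i j) 0; first by rewrite mul0r.
by rewrite -lnM ?posrE// mulr_ge0// ln_ge0// limits_ratio_ge1.
Qed.

End fixed_limits.

(** * Restricting the start to the limiting support *)

Section restriction.
Variables X P Q P' Q' : 'M[R]_(p, q).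
Hypotheses (GX : Gamma0 X) (L : ipfp_limits X P Q).
Let X' := restrict_mx X (Supp Q).

Lemma restrict_suppE i j : X' i j = if 0 < P i j then X i j else 0.
Proof.
rewrite mxE -(limits_supp_eq L).
by have -> : ((i, j) \in Supp Q) = (0 < Q i j) by apply/idP/idP; rewrite inE.
Qed.

Lemma restrict_gt0 i j : (0 < X' i j) = (0 < P i j).
Proof.
rewrite restrict_suppE.
by case: ifPn => [/(limits_supp_sub GX L)//|_]; rewrite ltxx.
Qed.

Lemma Gamma0_restrict : Gamma0 X'.
Proof.
apply: (Gamma0_Supp_sub (limits_Gamma0_odd L)) => [i j|[i j]].
  by rewrite restrict_suppE; case: ifP => // _; exact: (Gamma0_ge0 GX).
by rewrite /Supp /= restrict_gt0.
Qed.
Let GX' := Gamma0_restrict.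

Hypothesis L' : ipfp_limits X' P' Q'.

Let P0 := Gamma0_ge0 (limits_Gamma0_odd L).
Let P'0 := Gamma0_ge0 (limits_Gamma0_odd L').

Let suppP'P i j : 0 < P' i j -> 0 < P i j.
Proof. by move/(limits_supp_sub GX' L'); rewrite restrict_gt0. Qed.

Let neq_gt0 (t : R) : 0 <= t -> t != 0 -> 0 < t.
Proof. by move=> t0 tn; rewrite lt0r tn. Qed.

(** The four pairings of the two potentials with the two limits are all 0 but
    one, which is nonnegative; combined, they leave a sum of nonnegative terms,
    one for each column, that is at most 0. *)
Lemma restrict_colratio j : colratio b P j = colratio b P' j.
Proof.
pose g := colratio b P; pose g' := colratio b P'.
have g0 k : 0 < g k by apply: colratio_gt0 => //; exact: limits_Gamma0_odd L.
have g'0 k : 0 < g' k by apply: colratio_gt0 => //; exact: limits_Gamma0_odd L'.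
have H1 : 0 <= \sum_i a i * ln (rowratio a Q' i) + \sum_j colsum P j * ln (g' j).
  apply: (sum_ln_ratio_ge0 GX' L' (limits_rowsum L)) => // i k.
  by move/(neq_gt0 (P0 _ _)); rewrite restrict_gt0.
have H2 : \sum_i a i * ln (rowratio a Q' i) + \sum_j colsum P' j * ln (g' j) = 0.
  by apply: (sum_ln_ratio L' (limits_rowsum L')) => i k /(neq_gt0 (P'0 _ _)).
have H3 : \sum_i a i * ln (rowratio a Q i) + \sum_j colsum P j * ln (g j) = 0.
  by apply: (sum_ln_ratio L (limits_rowsum L)) => i k /(neq_gt0 (P0 _ _)).
have H4 : \sum_i a i * ln (rowratio a Q i) + \sum_j colsum P' j * ln (g j) = 0.
  apply: (sum_ln_ratio L (limits_rowsum L')) => i k.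
  by move/(neq_gt0 (P'0 _ _)); exact: suppP'P.
have term_ge0 k : 0 <= b k * ((g k - g' k) * (ln (g k) - ln (g' k))).
  by rewrite mulr_ge0 ?ln_sub_mul_ge0// ltW.
have sum0 : \sum_k b k * ((g k - g' k) * (ln (g k) - ln (g' k))) = 0.
  apply/eqP; rewrite eq_le sumr_ge0 ?andbT//.
  have -> : \sum_k b k * ((g k - g' k) * (ln (g k) - ln (g' k))) =
      \sum_j colsum P j * ln (g j) - \sum_j colsum P j * ln (g' j) -
      (\sum_j colsum P' j * ln (g j) - \sum_j colsum P' j * ln (g' j)).
    rewrite -!sumrB; apply: eq_bigr => k _.
    rewrite !(colsumE b0) -/(g k) -/(g' k); ring.
  lra.
have /(_ j isT) := psumr_eq0P (fun k _ => term_ge0 k) sum0.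
move/eqP; rewrite mulf_eq0 gt_eqF//= => /eqP.
exact: ln_sub_mul_eq0.
Qed.

(** [P' - P] has zero marginals, and its pairing with the logarithm starts from
    the same value for both procedures, since the two starts agree wherever
    [P' - P] is nonzero.  The strict monotonicity of the logarithm concludes. *)
Lemma restrict_limit_odd : P' = P.
Proof.
have colE j : colsum P j = colsum P' j.
  by rewrite !(colsumE b0) restrict_colratio.
have suppPP' i j : 0 < P i j -> 0 < P' i j.
  change (Supp P (i, j) -> Supp P' (i, j)).
  apply: (limits_maximal L'); split.
    by split=> //; [exact: limits_Gamma0_odd L|exact: limits_rowsum L].
  by move=> [k l]; rewrite /Supp /= restrict_gt0.
pose S := P' - P.
have Sr i : rowsum S i = 0.
  rewrite /rowsum; under eq_bigr do rewrite !mxE.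
  by rewrite sumrB -!/(rowsum _ i) (limits_rowsum L) (limits_rowsum L') subrr.
have Sc j : colsum S j = 0.
  rewrite /colsum; under eq_bigr do rewrite !mxE.
  by rewrite sumrB -!/(colsum _ j) colE subrr.
have SP i j : S i j != 0 -> 0 < P i j.
  apply: contraTT; rewrite -leNgt negbK => Pij.
  have /negP P'ij : ~ 0 < P' i j by move/suppP'P; rewrite ltNge Pij.
  rewrite !mxE; apply/eqP.
  have -> : P i j = 0 by apply/eqP; rewrite eq_le Pij P0.
  have -> : P' i j = 0 by apply/eqP; rewrite eq_le leNgt P'ij P'0.
  by rewrite subrr.
have ceE : cross_entropy S P' = cross_entropy S P.
  rewrite (cross_entropy_limit GX L Sr Sc SP).
  rewrite (cross_entropy_limit GX' L' Sr Sc) => [|i j /SP/suppPP'//].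
  apply: eq_bigr => i _; apply: eq_bigr => j _.
  have [->|/SP Pij] := eqVneq (S i j) 0; first by rewrite !mul0r.
  by rewrite restrict_suppE Pij.
have term_ge0 i j : 0 <= (P' i j - P i j) * (ln (P' i j) - ln (P i j)).
  have [Pij|Pij] := ltP 0 (P i j); first by rewrite ln_sub_mul_ge0// suppPP'.
  have [|/SP] := eqVneq (S i j) 0; last by rewrite ltNge Pij.
  by rewrite !mxE => ->; rewrite mul0r.
have sum0 : \sum_i \sum_j (P' i j - P i j) * (ln (P' i j) - ln (P i j)) = 0.
  rewrite -[RHS](_ : cross_entropy S P' - cross_entropy S P = 0); last first.
    by rewrite ceE subrr.
  rewrite -sumrB; apply: eq_bigr => i _; rewrite -sumrB.
  by apply: eq_bigr => j _; rewrite !mxE mulrBr.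
apply/matrixP => i j.
have row0 := psumr_eq0P (fun k _ => sumr_ge0 _ (fun l _ => term_ge0 k l)) sum0.
have /(_ j isT) t0 := psumr_eq0P (fun l _ => term_ge0 i l) (row0 i isT).
have [Pij|Pij] := ltP 0 (P i j).
  by apply: ln_sub_mul_eq0 t0 => //; exact: suppPP'.
have [|/SP] := eqVneq (S i j) 0; last by rewrite ltNge Pij.
by rewrite !mxE => /eqP; rewrite subr_eq0 => /eqP.
Qed.

Lemma restrict_limit_even : Q' = Q.
Proof. by rewrite (limits_T_C L) (limits_T_C L') restrict_limit_odd. Qed.

End restriction.
End limit_pair.

(** * Matrix limits and conclusion *)

Lemma cvg_matrix {R : realType} {T : Type} {F : set_system T} {FF : Filter F}
    {p q : nat} (X : T -> 'M[R]_(p, q)) (P : 'M[R]_(p, q)) :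
  (forall i j, X t i j @[t --> F] --> P i j) -> X @ F --> P.
Proof.
move=> XP; apply/cvg_mx_entourageP => A entA.
apply: filter_forall => i; apply: filter_forall => j.
have /cvg_entourageP /(_ A entA) := XP i j. move=> h.
by apply: (@filterS _ F _ (fun t => A (P i j, X t i j))) h => t At; apply/mem_set.
Qed.

Lemma lim_matrix {R : realType} {T : Type} {F : set_system T}
    {FF : ProperFilter F} {p q : nat} (X : T -> 'M[R]_(p, q)) (P : 'M[R]_(p, q)) :
  (forall i j, X t i j @[t --> F] --> P i j) -> lim (X @ F) = P.
Proof.
move=> XP; have XlP : X @ F --> P by exact: cvg_matrix.
have Xlim : X @ F --> lim (X @ F) by exact: (cvgP _ XlP).
apply/matrixP => i j.
have Xij : X t i j @[t --> F] --> (lim (X @ F) : 'M[R]_(p, q)) i j.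
  exact: (@cvg_comp _ _ _ X (fun M => M i j) F _ _ Xlim
    (@coord_continuous R p q i j _)).
exact: cvg_real_unique Xij (XP i j).
Qed.

Theorem theorem6 (R : realType) (p q : nat) (hp : (2 <= p)%N) (hq : (2 <= q)%N)
    (a : 'I_p -> R) (b : 'I_q -> R)
    (a_gt0 : forall i, 0 < a i) (b_gt0 : forall j, 0 < b j)
    (a_sum : \sum_i a i = 1) (b_sum : \sum_j b j = 1)
    (X0 : 'M[R]_(p, q)) (hX0 : Gamma1 X0) :
  let X := ipfp a b X0 in
  let Leven := lim (X n.*2 @[n --> \oo]) in
  let Lodd := lim (X n.*2.+1 @[n --> \oo]) in
  let a' := fun i : 'I_p => a i * lim (rowratio a (X n.*2) i @[n --> \oo]) in
  let b' := fun j : 'I_q => b j * lim (colratio b (X n.*2.+1) j @[n --> \oo]) in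
  let Sigma := Supp Leven in
  let X0' := restrict_mx X0 Sigma in
  let X' := ipfp a b X0' in
  (* the limits above exist, and a', b' have positive components *)
  [/\ cvg (X n.*2 @[n --> \oo]),
      cvg (X n.*2.+1 @[n --> \oo]),
      forall i, cvg (rowratio a (X n.*2) i @[n --> \oo]) /\ 0 < a' i
    & forall j, cvg (colratio b (X n.*2.+1) j @[n --> \oo]) /\ 0 < b' j] /\
  (* common support of the two limits *)
  (Supp Lodd = Sigma /\
   Sigma = \bigcup_(S in Gamma_in a' b X0 `|` Gamma_in a b' X0) Supp S) /\
  (* the procedure can be started at X0', and has the same limit points *)
  [/\ Gamma0 X0',
      X' n.*2 @[n --> \oo] --> Leven
    & X' n.*2.+1 @[n --> \oo] --> Lodd].
Proof.
have [GX _] := hX0.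
have [P [Q L]] := ipfp_limits_exist a_gt0 b_gt0 a_sum b_sum GX.
move=> X Leven Lodd a' b' Sigma X0' X'.
have LevenE : Leven = Q by apply: lim_matrix => i j; exact: (limits_even L).
have LoddE : Lodd = P by apply: lim_matrix => i j; exact: (limits_odd L).
have cR i : rowratio a (X n.*2) i @[n --> \oo] --> rowratio a Q i.
  by apply: cvg_rowratio => k l; exact: (limits_even L).
have cC j : colratio b (X n.*2.+1) j @[n --> \oo] --> colratio b P j.
  by apply: cvg_colratio => k l; exact: (limits_odd L).
have a'E : a' = rowsum Q.
  apply/funext => i; rewrite (rowsumE a_gt0); congr (_ * _).
  exact: (cvg_lim _ (cR i)).
have b'E : b' = colsum P.
  apply/funext => j; rewrite (colsumE b_gt0); congr (_ * _).
  exact: (cvg_lim _ (cC j)).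
have GX0' : Gamma0 X0'.
  by rewrite /X0' /Sigma LevenE; exact: (Gamma0_restrict a_gt0 b_gt0 GX L).
have [P' [Q' L']] := ipfp_limits_exist a_gt0 b_gt0 a_sum b_sum GX0'.
have [EP EQ] : P' = P /\ Q' = Q.
  move: L'; rewrite /X0' /Sigma LevenE => L'.
  split; first exact: (restrict_limit_odd a_gt0 b_gt0 GX L L').
  exact: (restrict_limit_even a_gt0 b_gt0 GX L L').
split; [split|split].
- by apply: (cvgP Q); apply: cvg_matrix => i j; exact: (limits_even L).
- by apply: (cvgP P); apply: cvg_matrix => i j; exact: (limits_odd L).
- move=> i; split; first exact: (cvgP _ (cR i)).
  by rewrite a'E; exact: rowsum_gt0 (limits_Gamma0_even L) i.
- move=> j; split; first exact: (cvgP _ (cC j)).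
  by rewrite b'E; exact: colsum_gt0 (limits_Gamma0_odd L) j.
- rewrite /Sigma LevenE LoddE a'E b'E; split; last first.
    exact: (limits_support a_gt0 b_gt0 a_sum GX L).
  by apply/seteqP; split=> -[i j]; rewrite /Supp /= (limits_supp_eq b_gt0 L).
- split => //; rewrite ?LevenE ?LoddE; apply: cvg_matrix => i j.
  + by rewrite -EQ; exact: (limits_even L').
  + by rewrite -EP; exact: (limits_odd L').
Qed.
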